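(* Let $\varnothing\ne T\subset\mathbb{R}$ and let $(M,d)$ be a metric space. Suppose $\{f_j\}_{j=1}^\infty,\{g_j\}_{j=1}^\infty\subset M^T$ are two sequences of functions such that (a) $\{f_j\}$ is pointwise precompact on $T$, (b) $\{g_j\}$ is pointwise convergent on $T$ to a function $g\in M^T$, and $$\mu_n\equiv\limsup_{j\to\infty}\nu_n(f_j,g_j)=o(n).$$ Then there is a subsequence of $\{f_j\}$ which converges pointwise on $T$ to a function $f\in M^T$ such that $\nu_n(f,g)\le\mu_n$ for all $n\in\mathbb{N}$.
   Context: $M^T$ is the set of all functions $T\to M$. A sequence $\{f_j\}\subset M^T$ is pointwise precompact on $T$ if for every $t\in T$ the closure in $M$ of the set $\{f_j(t):j\in\mathbb{N}\}$ is compact. Pointwise convergence $f_j\to f$ on $T$ means $\lim_{j\to\infty}d(f_j(t),f(t))=0$ for all $t\in T$. For $f,g\in M^T$ and $s,t\in T$, the joint increment is $$|(f,g)(\{s,t\})|=\sup_{z\in M}\bigl|d(f(s),z)+d(g(t),z)-d(f(t),z)-d(g(s),z)\bigr|.$$ For $n\in\mathbb{N}=\{1,2,\dots\}$, $\{I_i\}_1^n\prec T$ denotes a collection of $n$ two-point subsets $I_i=\{s_i,t_i\}$ of $T$ with $s_1<t_1\le s_2<t_2\le\dots\le s_n<t_n$. The joint modulus of variation of $f,g\in M^T$ is the sequence $\{\nu_n(f,g)\}_{n=1}^\infty\subset[0,\infty]$ defined by $$\nu_n(f,g)=\sup\Bigl\{\sum_{i=1}^n|(f,g)(I_i)|:\{I_i\}_1^n\prec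 T\Bigr\}.$$ If $T$ is finite with $\#(T)\ge2$ elements, this formula is used for $n\le\#(T)-1$, and $\nu_n(f,g)=\nu_{\#(T)-1}(f,g)$ for $n>\#(T)-1$; if $T$ has one element, $\nu_n(f,g)=0$ for all $n$. For a nondecreasing sequence $\{\mu_n\}\subset[0,\infty]$, $\mu_n=o(n)$ means that all $\mu_n$ are finite and $\lim_{n\to\infty}\mu_n/n=0$. *)

(* Defs.v *)
From HB Require Import structures.
From mathcomp Require Import all_boot all_order all_algebra.
From mathcomp Require Import finmap.
From mathcomp Require Import all_classical all_reals all_analysis.

Set Implicit Arguments.
Unset Strict Implicit.
Unset Printing Implicit Defensive.

Import Order.TTheory GRing.Theory Num.Theory.
Import numFieldNormedType.Exports.

Local Open Scope classical_set_scope.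
Local Open Scope ring_scope.

(* Elements of M^T are functions on the subtype [set_type T] (the coercion of
   the set T to a type); [\val] is the inclusion of T into R. *)

Definition ptw_precompact (R : realType) (T : set R) (M : metricType R)
    (f : nat -> T -> M) : Prop :=
  forall t : T, compact (closure [set f j t | j in [set: nat]]).

Definition ptw_cvg (R : realType) (T : set R) (M : metricType R)
    (f : nat -> T -> M) (f0 : T -> M) : Prop :=
  forall t : T, mdist (f j t) (f0 t) @[j --> \oo] --> (0 : R).

(* The supremum over z is finite, at most d(f s, f t) + d(g s, g t); it is
   taken in the extended reals, where the modulus of variation takes its
   values. *)
Definition joint_incr (R : realType) (T : set R) (M : metricType R)
    (f g : T -> M) (s t : T) : \bar R :=
  ereal_sup [set (`|mdist (f s) z + mdist (g t) z
                    - mdist (f t) z - mdist (g s) z|)%:E | z in [set: M]].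

(* s_1 < t_1 <= s_2 < t_2 <= ... <= s_n < t_n *)
Definition ordered_pairs (R : realType) (T : set R) (n : nat)
    (s t : 'I_n -> T) : Prop :=
  (forall i, \val (s i) < \val (t i)) /\
  (forall i j : 'I_n, j = i.+1 :> nat -> \val (t i) <= \val (s j)).

Definition joint_var (R : realType) (T : set R) (M : metricType R)
    (f g : T -> M) (n : nat) : \bar R :=
  ereal_sup [set v : \bar R | exists s t : 'I_n -> T, ordered_pairs s t /\
    v = (\sum_(i < n) joint_incr f g (s i) (t i))%E].

(* The joint modulus of variation; the sequence is indexed by n >= 1, the value
   at n = 0 is irrelevant.  For finite T the index is cut off at #T - 1; if T
   has one element this leaves only the empty sum, so that the value is 0 (see
   [joint_modvar_set1]). *)
Definition joint_modvar (R : realType) (T : set R) (M : metricType R)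
    (f g : T -> M) (n : nat) : \bar R :=
  joint_var f g (if `[< finite_set T >] then minn n #|` fset_set T|.-1 else n).

Lemma joint_modvar_set1 (R : realType) (x : R) (M : metricType R)
    (f g : [set x] -> M) (n : nat) : joint_modvar f g n = 0%E.
Proof.
rewrite /joint_modvar asboolT; last exact: finite_set1.
rewrite fset_set1 cardfs1 minn0 /joint_var.
rewrite (_ : [set v | _] = [set 0%E]) ?ereal_sup1//.
apply/seteqP; split => [v [s [t [_ ->]]]|v /= ->]; first by rewrite big_ord0.
have e (i : 'I_0) : [set x] by case: i.
by exists e, e; split; [split; case|rewrite big_ord0].
Qed.

(* mu_n = o(n), for a sequence indexed by n >= 1 *)
Definition is_o_n (R : realType) (mu : nat -> \bar R) : Prop :=
  (forall n, (0 < n)%N -> mu n \is a fin_num) /\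
  fine (mu n) / n%:R @[n --> \oo] --> (0 : R).

(* Main.v *)
Require Import Defs.
From HB Require Import structures.
From mathcomp Require Import all_boot all_order all_algebra.
From mathcomp Require Import finmap lra.
From mathcomp Require Import all_classical all_reals all_analysis.

(** The joint increment of [f, g] at [s, t] is the sup-distance between [h s]
and [h t], where [h u] is the bounded function [d(f u, z) - d(g u, z)] of [z].  So
the joint modulus of variation is the ordinary modulus of variation of [h], and
the theorem is a selection principle for the maps [h_j]; a limit of [h_j t]
gives one of [f_j t], because [g_j t] converges and [z] may be taken to be a
value of [f].

A nonprincipal ultrafilter [U] on the indices takes the place of Helly-type
selections.  Compactness gives a [U]-limit [f0 t] of [f_j t] at every [t], and
the increments of the limit are at most the [U]-limits of the increments
([joint_var_limit_le], which also yields the bound on the modulus).  It remains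
to realize [f0] as the limit of one subsequence, which can be asked to obey
countably many conditions that hold [U]-almost everywhere
([filter_subsequence]).

The condition [mu_n = o(n)] makes countably many conditions sufficient.  Call
[t] an [e]-jump if, for [U]-almost all [j], an increment of index [j] exceeds
[e] inside each rational interval around [t].  Placing [n] jumps in disjoint
intervals gives [n] ordered pairs of points with total increment at least
[n * e], which exceeds [mu_n] for a suitable [n]; hence the [e]-jumps are
finitely many ([finite_jump_points]).  The subsequence is required to converge
to [f0] at all [1/m]-jumps and at one sample point of [T] in each rational
interval that meets [T], and eventually to have no increment above [1/m] in each rational
interval where [U]-almost all indices have none.  Any other [t] lies, for each
[m], in such a calm interval, and is compared there with its sample point
([mdist_lt_of_incr_at]). *)

Set Implicit Arguments.
Unset Strict Implicit.
Unset Printing Implicit Defensive.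

Import Order.TTheory GRing.Theory Num.Theory.
Import numFieldNormedType.Exports.

Local Open Scope classical_set_scope.
Local Open Scope ring_scope.

(** * Filters, subsequences and limits superior *)

(** Diagonal extraction: the [n]-th index is taken in the first [n] sets of the
countable family, whose intersection is [U]-large and therefore contains
arbitrarily large indices. *)
Lemma filter_subsequence (U : set_system nat) (C : set (set nat)) :
  ProperFilter U -> \oo `<=` U -> countable C -> C `<=` U ->
  exists2 phi : nat -> nat, {homo phi : i j / (i < j)%N} &
    forall A, C A -> \forall j \near \oo, A (phi j).
Proof.
move=> FU ooU /countable_injP[rk rk_inj] CU.
have U_below n : U [set q | forall A, C A -> (rk A < n)%N -> A q].
  elim: n => [|n IHn]; first by apply: filterS filterT.
  have [[A [CA rkA]]|noA] := pselect (exists A, C A /\ rk A = n).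
    apply: filterS (filterI IHn (CU _ CA)) => q [below Aq] B CB.
    rewrite ltnS leq_eqVlt => /predU1P[rkB|]; last exact: below.
    by rewrite (rk_inj B A) ?inE// rkA.
  apply: filterS IHn => q below B CB; rewrite ltnS leq_eqVlt.
  by move=> /predU1P[rkB|]; [case: noA; exists B|exact: below].
have next n p : {q | (p < q)%N /\ forall A, C A -> (rk A < n)%N -> A q}.
  apply: cid.
  have [q [pq qA]] :=
    filter_ex (filterI (ooU _ (nbhs_infty_gt p)) (U_below n)).
  by exists q.
pose phi := fix phi n := if n is m.+1 then sval (next n (phi m))
                         else sval (next 0%N 0%N).
exists phi.
  apply: homo_ltn => [? ? ?|n]; first exact: ltn_trans.
  by case: (svalP (next n.+1 (phi n))).
move=> A CA; exists (rk A).+1 => //= -[//|n] /= An.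
by case: (svalP (next n.+1 (phi n))) => _; apply.
Qed.

(** A cluster point along [U] is a limit along [U], since an ultrafilter contains
either the indices close to it or those far from it. *)
Lemma ultra_limit (R : realType) (M : metricType R) (U : set_system nat)
    (u : nat -> M) :
  UltraFilter U -> compact (closure [set u j | j in [set: nat]]) ->
  exists p, forall e, 0 < e -> U [set j | mdist (u j) p < e].
Proof.
move=> UU cpt.
have [|p [_ clp]] := cpt (u @ U) _.
  apply: (@filterS _ U _ setT) filterT => j _.
  by apply: subset_closure; exists j.
exists p => e e0; have [//|farU] :=
  @in_ultra_setVsetC _ U [set j | mdist (u j) p < e] UU.
have [||q [uq]] := clp (u @` ~` [set j | mdist (u j) p < e]) (ball p e).
- by apply: (@filterS _ U) farU => j fj; exists j.
- exact: nbhsx_ballx.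
- by rewrite ballEmdist /=; case: uq => j fj <-; rewrite metric_sym => /fj.
Qed.

Lemma countable_setU (X : Type) (A B : set X) :
  countable A -> countable B -> countable (A `|` B).
Proof.
move=> cA cB; rewrite -bigcup2E; apply: bigcup_countable => // i _.
by case: i => [|[|i]].
Qed.

Lemma near_subsequence (phi : nat -> nat) (P : set nat) :
  {homo phi : i j / (i < j)%N} -> (\forall j \near \oo, P j) ->
  \forall j \near \oo, P (phi j).
Proof.
move=> phi_lt [N _ NP]; exists N => //= j Nj; apply: NP => /=.
apply: leq_trans Nj _; elim: j => // j IHj.
by apply: leq_ltn_trans IHj _; exact: phi_lt.
Qed.

Lemma limn_esup_lt_near (R : realType) (u : nat -> \bar R) (c : \bar R) :
  (limn_esup u < c)%E -> \forall j \near \oo, (u j < c)%E.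
Proof.
move=> /ereal_inf_lt[_ [V ooV <-] supV]; apply: filterS ooV => j Vj.
by apply: le_lt_trans supV; apply: ereal_sup_ubound; exists j.
Qed.

(** * Increments at a fixed point of the target space *)

Section Increments.
Variables (R : realType) (T : set R) (M : metricType R).
Implicit Types (f g : T -> M) (s t : T).

Definition incr_at f g s t (z : M) : R :=
  `|mdist (f s) z + mdist (g t) z - mdist (f t) z - mdist (g s) z|.

Lemma incr_atC f g s t z : incr_at f g s t z = incr_at f g t s z.
Proof. by rewrite /incr_at -normrN; congr `|_|; lra. Qed.

Lemma dist_mdist_le (x y z : M) : `|mdist x z - mdist y z| <= mdist x y.
Proof.
rewrite ler_norml; have := metric_triangle x y z; have := metric_triangle y x z.
by rewrite (metric_sym y x) => h1 h2; apply/andP; split; lra.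
Qed.

Lemma incr_at_perturb f g f' g' s t z :
  incr_at f g s t z <= incr_at f' g' s t z
    + (mdist (f s) (f' s) + mdist (g t) (g' t)
       + mdist (f t) (f' t) + mdist (g s) (g' s)).
Proof.
rewrite /incr_at.
have := dist_mdist_le (f s) (f' s) z; have := dist_mdist_le (g t) (g' t) z.
have := dist_mdist_le (f t) (f' t) z; have := dist_mdist_le (g s) (g' s) z.
rewrite !ler_norml => /andP[a1 a2] /andP[b1 b2] /andP[c1 c2] /andP[d1 d2].
set x := mdist (f' s) z + mdist (g' t) z - mdist (f' t) z - mdist (g' s) z.
have := ler_norm x; have := lerNnormlW (lexx `|x|); rewrite /x.
by move=> h1 h2; apply/andP; split; lra.
Qed.

(** For [z := f' t] the number [d(f t, z)] is [h t z + d(g t, z)], while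
[0 = d(f' t, z)] is [h' t z + d(g' t, z)], where [h u z] is
[d(f u, z) - d(g u, z)] and likewise for [h'].  Subtracting, and passing from
[t] to [s] through the two increments, costs five terms of size [d].  This is
how closeness at [s] is carried over to [t]. *)
Lemma mdist_lt_of_incr_at f g f' g' s t (d : R) :
  incr_at f g s t (f' t) <= d -> incr_at f' g' s t (f' t) <= d ->
  mdist (f s) (f' s) < d -> mdist (g s) (g' s) < d -> mdist (g t) (g' t) < d ->
  mdist (f t) (f' t) < 5 * d.
Proof.
set z := f' t; have z0 : mdist (f' t) z = 0 by exact: mdistxx.
rewrite /incr_at z0.
have := dist_mdist_le (f s) (f' s) z; have := dist_mdist_le (g t) (g' t) z.
have := dist_mdist_le (g s) (g' s) z.
rewrite !ler_norml => /andP[a1 a2] /andP[b1 b2] /andP[c1 c2].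
by move=> /andP[h1 _] /andP[_ h2] fs gs gt; lra.
Qed.

Lemma incr_at_le_joint_incr f g s t z :
  ((incr_at f g s t z)%:E <= joint_incr f g s t)%E.
Proof. by apply: ereal_sup_ubound; exists z. Qed.

Lemma joint_incr_le_perturb f g f' g' s t d :
  mdist (f s) (f' s) < d -> mdist (g t) (g' t) < d ->
  mdist (f t) (f' t) < d -> mdist (g s) (g' s) < d ->
  (joint_incr f g s t <= joint_incr f' g' s t + (4 * d)%:E)%E.
Proof.
move=> d1 d2 d3 d4; apply: ge_ereal_sup => _ [z _ <-].
apply: (@le_trans _ _ ((incr_at f' g' s t z)%:E + (4 * d)%:E)%E); last first.
  by rewrite leeD2r// incr_at_le_joint_incr.
rewrite -EFinD lee_fin.
by apply: le_trans (incr_at_perturb f g f' g' s t z) _; rewrite lerD2l; lra.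
Qed.

End Increments.

(** * Points with large increments in every neighbourhood *)

Section Jumps.
Variables (R : realType) (T : set R) (M : metricType R).
Variables (f g : nat -> T -> M) (U : set_system nat).

Definition oscillation (e a b : R) : set nat :=
  [set j | exists s t z, [/\ a < val s, val s < val t, val t < b
                           & e < incr_at (f j) (g j) s t z]].

(** Rational endpoints leave only countably many intervals to decide along a
subsequence. *)
Definition jump_points (e : R) : set T :=
  [set t | forall a b : rat, ratr a < val t < ratr b ->
     U (oscillation e (ratr a) (ratr b))].

Lemma incr_at_le_of_no_oscillation (e a b : R) j s t z : 0 <= e ->
  ~ oscillation e a b j -> a < val s < b -> a < val t < b ->
  incr_at (f j) (g j) s t z <= e.
Proof.
move=> e0 no_osc /andP[as_ sb] /andP[at_ tb]; rewrite leNgt; apply/negP => ez.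
have [st|ts|/val_inj st] := ltgtP (val s) (val t).
- by apply: no_osc; exists s, t, z.
- by apply: no_osc; exists t, s, z; rewrite incr_atC.
- move: ez; rewrite st ltNge /incr_at -addrA -opprD subrr.
  by rewrite normr0 e0.
Qed.

(** Among [n + 2] jumps, separated by rationals [q_0 < ... < q_n], the [n] inner
ones lie in the disjoint intervals [(q_i, q_(i+1))].  One index [j] oscillates
on all of these, and the resulting [n] ordered pairs contradict the bound. *)
Lemma finite_jump_points (n : nat) (e : R) : ProperFilter U ->
  U [set j | (joint_var (f j) (g j) n < (n%:R * e)%:E)%E] ->
  finite_set (jump_points e).
Proof.
move=> FU Uvar; apply: contrapT => /(@infinite_set_fset _ _ n.+2)[B Bjump szB].
pose s := sort <=%R [seq val t | t <- enum_fset B].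
have sz_s : (n.+2 <= size s)%N by rewrite size_sort size_map.
have s_lt : sorted <%R s.
  rewrite sort_lt_sorted map_inj_uniq ?fset_uniq//; exact: val_inj.
have s_jump i : (i < n.+2)%N -> exists2 t, val t = s`_i & jump_points e t.
  move=> i_lt; have : s`_i \in s by rewrite mem_nth// (leq_trans i_lt).
  by rewrite mem_sort => /mapP[t tB st]; exists t => //; exact: Bjump.
have sep i : exists q : rat, (i < n.+1)%N -> s`_i < ratr q < s`_i.+1.
  have [i_lt|] := ltnP i n.+1; last by exists 0.
  have si : s`_i < s`_i.+1.
    by rewrite lt_sorted_ltn_nth ?inE ?ltnSn// (leq_trans _ sz_s)// ltnW.
  by have [q /[!in_itv]/=] := rat_in_itvoo si; exists q.
have [q qP] := choice sep.
have Uosc : U [set j | forall i : 'I_n,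
    oscillation e (ratr (q i)) (ratr (q i.+1)) j].
  apply: filter_forall => i.
  have [|t st jt] := s_jump i.+1; first by rewrite ltnS ltnW// ltnS.
  apply: jt; rewrite st.
  have /andP[_ ->] := qP i (ltnW (ltn_ord i : (i.+1 < n.+1)%N)).
  by have /andP[->] := qP i.+1 (ltn_ord i : (i.+1 < n.+1)%N).
have [j [/= var_lt osc_j]] := filter_ex (filterI Uvar Uosc).
have [u uP] := choice osc_j; have [v vP] := choice uP.
move: var_lt; apply/negP; rewrite -leNgt.
apply: (@le_trans _ _ (\sum_(i < n) joint_incr (f j) (g j) (u i) (v i))%E).
  have -> : (n%:R * e)%:E = (\sum_(i < n) e%:E)%E :> \bar R.
    by rewrite sumEFin sumr_const card_ord mulr_natl.
  apply: lee_sum => i _; have [z [_ _ _ ez]] := vP i.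
  by apply: le_trans (incr_at_le_joint_incr _ _ _ _ z); rewrite lee_fin ltW.
apply: ereal_sup_ubound; exists u, v; split=> //; split=> [i|i k ki].
  by have [z []] := vP i.
have [z [_ _ vi _]] := vP i; have [z' [uk _ _ _]] := vP k.
by rewrite ltW// (lt_trans vi)//; rewrite -ki.
Qed.

End Jumps.

(** * Lower semicontinuity of increments and variation *)

Section Limits.
Variables (R : realType) (T : set R) (M : metricType R).
Variables (f g : nat -> T -> M) (f0 g0 : T -> M) (U : set_system nat).
Hypothesis FU : ProperFilter U.
Hypothesis fU : forall t (e : R), 0 < e -> U [set j | mdist (f j t) (f0 t) < e].
Hypothesis gU : forall t (e : R), 0 < e -> U [set j | mdist (g j t) (g0 t) < e].

(** Only the finitely many points of a given family of pairs matter, so a single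
index [j] near the limit at all of them can be used. *)
Lemma joint_var_limit_le (n : nat) (c : \bar R) :
  U [set j | (joint_var (f j) (g j) n <= c)%E] ->
  (joint_var f0 g0 n <= c)%E.
Proof.
move=> Uc; apply: ge_ereal_sup => _ [s [t [st ->]]]; apply/lee_addgt0Pr => e e0.
pose d := e / n.+1%:R / 4.
have d0 : 0 < d by rewrite !divr_gt0.
have Ud : U [set j | forall i : 'I_n,
    [/\ mdist (f j (s i)) (f0 (s i)) < d, mdist (g j (t i)) (g0 (t i)) < d,
        mdist (f j (t i)) (f0 (t i)) < d & mdist (g j (s i)) (g0 (s i)) < d]].
  apply: filter_forall => i.
  by apply: filterS2 (filterI (fU (s i) d0) (fU (t i) d0))
    (filterI (gU (s i) d0) (gU (t i) d0)) => j [? ?] [].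
have [j [/= var_j close]] := filter_ex (filterI Uc Ud).
apply: (@le_trans _ _ (\sum_(i < n)
    (joint_incr (f j) (g j) (s i) (t i) + (4 * d)%:E))%E).
  apply: lee_sum => i _; have [d1 d2 d3 d4] := close i.
  by apply: joint_incr_le_perturb; rewrite metric_sym.
rewrite big_split /= sumEFin sumr_const card_ord; apply: leeD.
  by apply: le_trans var_j; apply: ereal_sup_ubound; exists s, t.
rewrite lee_fin mulrC divfK//.
have n_neq0 : n.+1%:R != 0 :> R by rewrite pnatr_eq0.
by rewrite -[leRHS](divfK n_neq0) mulr_natr ler_pMn2l ?divr_gt0.
Qed.

Lemma incr_at_limit_le s t z (c : R) :
  U [set j | incr_at (f j) (g j) s t z <= c] -> incr_at f0 g0 s t z <= c.
Proof.
move=> Uc; apply/ler_addgt0Pr => e e0; have d0 : 0 < e / 4 by rewrite divr_gt0.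
have [j [[] []]] := filter_ex (filterI
  (filterI (filterI (fU s d0) (fU t d0)) (filterI (gU s d0) (gU t d0))) Uc).
move=> /= fs ft [gs gt] incr_j.
apply: le_trans (incr_at_perturb f0 g0 (f j) (g j) s t z) _.
rewrite (metric_sym (f0 s)) (metric_sym (f0 t)).
by rewrite (metric_sym (g0 s)) (metric_sym (g0 t)); lra.
Qed.

End Limits.

(** * Extraction of the convergent subsequence *)

(** A finite [T] is set apart because there the index of the joint modulus of
variation is cut off: its value at [n] may be a supremum over fewer than [n]
pairs, hence not [joint_var] at [n]. *)
Lemma countable_jump_points (R : realType) (T : set R) (M : metricType R)
    (f g : nat -> T -> M) (U : set_system nat) (e : R) :
  let mu := fun n : nat => limn_esup (fun j => joint_modvar (f j) (g j) n) in
  ProperFilter U -> \oo `<=` U -> is_o_n mu -> 0 < e ->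
  countable (jump_points f g U e).
Proof.
move=> mu FU ooU [mu_fin mu_o] e0; have [finT|infT] := pselect (finite_set T).
  have /countable_injP[h h_inj] := finite_set_countable finT.
  apply/countable_injP; exists (h \o val) => x y _ _ /= hxy.
  by apply/val_inj/h_inj => //; rewrite inE; exact: set_valP.
have /cvgrPdist_lt/(_ e e0) mu_lt := mu_o.
have [n [/= n0]] := filter_ex (filterI (nbhs_infty_gt 0) mu_lt).
rewrite distrC subr0 => /ltr_normlW; rewrite ltr_pdivrMr ?ltr0n// => mu_n.
apply/finite_set_countable/(@finite_jump_points _ _ _ _ _ _ n).
apply: ooU; have : (mu n < (n%:R * e)%:E)%E.
  by rewrite -(fineK (mu_fin _ n0)) lte_fin mulrC.
move=> /limn_esup_lt_near; apply: filterS => j.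
by rewrite /joint_modvar asboolF.
Qed.

Theorem theorem1 (R : realType) (T : set R) (M : metricType R)
    (f g : nat -> T -> M) (g0 : T -> M) :
  T !=set0 ->
  ptw_precompact f ->
  ptw_cvg g g0 ->
  let mu := fun n : nat => limn_esup (fun j => joint_modvar (f j) (g j) n) in
  is_o_n mu ->
  exists2 phi : nat -> nat, {homo phi : i j / (i < j)%N} &
  exists2 f0 : T -> M, ptw_cvg (fun j => f (phi j)) f0 &
    forall n : nat, (0 < n)%N -> (joint_modvar f0 g0 n <= mu n)%E.
Proof.
move=> [x0 Tx0] f_cpt g_cvg mu mu_o.
have [U [UU ooU]] := ultraFilterLemma eventually_filter.
have [f0 fU] := choice (fun t => ultra_limit UU (f_cpt t)).
have g_near t e : 0 < e -> \forall j \near \oo, mdist (g j t) (g0 t) < e.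
  move=> e0; have /cvgrPdist_lt/(_ e e0) := g_cvg t; apply: filterS => j.
  by rewrite distrC subr0 => /ltr_normlW.
have gU t e : 0 < e -> U [set j | mdist (g j t) (g0 t) < e].
  by move=> e0; apply: ooU; exact: g_near.
have eps0 m : 0 < m.+1%:R^-1 :> R by rewrite invr_gt0.
have sample_ex (ab : rat * rat) : exists s : T, forall t : T,
    ratr ab.1 < val t < ratr ab.2 -> ratr ab.1 < val s < ratr ab.2.
  have [[s sab]|none] := pselect (exists s : T, ratr ab.1 < val s < ratr ab.2).
    by exists s.
  by exists (SigSub (mem_set Tx0)) => t tab; case: none; exists t.
have [sample sampleP] := choice sample_ex.
pose S := (\bigcup_(m in [set: nat]) jump_points f g U m.+1%:R^-1)
          `|` range sample.
have countS : countable S.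
  apply: countable_setU; last exact: sub_countable (card_image_le _ _) _.
  apply: bigcup_countable => // m _; exact: countable_jump_points.
(* [calm] conditions are imposed only when they hold [U]-almost everywhere;
   intersecting their range with [U] keeps the family countable. *)
pose calm (p : nat * (rat * rat)) :=
  ~` oscillation f g p.1.+1%:R^-1 (ratr p.2.1) (ratr p.2.2).
pose near_limit (p : T * nat) :=
  [set j | mdist (f j p.1) (f0 p.1) < p.2.+1%:R^-1].
pose C := near_limit @` (S `*` [set: nat]) `|` (range calm `&` U).
have countC : countable C.
  apply: countable_setU.
    by apply: sub_countable (card_image_le _ _) _; exact: countableX.
  apply: sub_countable (subset_card_le (@subIsetl _ _ _)) _.
  exact: sub_countable (card_image_le _ _) _.
have CU : C `<=` U.
  by move=> _ [[[s m] _ <-]|[_ //]]; apply: fU.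
have [phi phi_lt phiC] := filter_subsequence _ ooU countC CU.
exists phi => //; exists f0; last first.
  move=> n n0; have [mu_fin _] := mu_o.
  apply/lee_addgt0Pr => e e0.
  apply: (joint_var_limit_le _ fU gU); apply: ooU.
  have : (mu n < mu n + e%:E)%E by rewrite lteDl// ?mu_fin.
  by move=> /limn_esup_lt_near; apply: filterS => j /ltW.
have cvgS s e : S s -> 0 < e ->
    \forall j \near \oo, mdist (f (phi j) s) (f0 s) < e.
  move=> Ss e0.
  have [m me] := filter_ex (near_infty_natSinv_lt (PosNum e0)).
  have : C (near_limit (s, m)) by left; exists (s, m).
  by move=> /phiC; apply: filterS => j /lt_trans; apply.
move=> t; apply/cvgrPdist_lt => /= e e0.
suff : \forall j \near \oo, mdist (f (phi j) t) (f0 t) < e.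
  by apply: filterS => j; rewrite distrC subr0 ger0_norm ?mdist_ge0.
have [St|notS] := pselect (S t); first exact: cvgS.
have d0 : 0 < e / 5 by rewrite divr_gt0.
have [m me] := filter_ex (near_infty_natSinv_lt (PosNum d0)).
have {}me : m.+1%:R^-1 < e / 5 := me.
have : exists ab : rat * rat, ratr ab.1 < val t < ratr ab.2 /\ U (calm (m, ab)).
  apply: contrapT => jump; apply: notS; left; exists m => // a b tab.
  have [//|] :=
    in_ultra_setVsetC (oscillation f g m.+1%:R^-1 (ratr a) (ratr b)) UU.
  by move=> calm_ab; case: jump; exists (a, b).
move=> [ab [tab calm_ab]].
have sab := sampleP _ _ tab; set s := sample ab in sab.
have incr_le j : calm (m, ab) j ->
    incr_at (f j) (g j) s t (f0 t) <= m.+1%:R^-1.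
  move=> calm_j; apply: incr_at_le_of_no_oscillation calm_j sab tab.
  exact: ltW.
have incr0_le : incr_at f0 g0 s t (f0 t) <= m.+1%:R^-1.
  by apply: (incr_at_limit_le _ fU gU); apply: filterS calm_ab => j /incr_le.
have phi_calm : \forall j \near \oo, calm (m, ab) (phi j).
  by apply: phiC; right; split=> //; exists (m, ab).
have Ss : S s by right; exists ab.
have g_phi x := near_subsequence phi_lt (g_near x _ d0).
near=> j.
have j1 : mdist (f (phi j) s) (f0 s) < e / 5 by near: j; exact: cvgS.
have j2 : mdist (g (phi j) s) (g0 s) < e / 5 by near: j; exact: g_phi.
have j3 : mdist (g (phi j) t) (g0 t) < e / 5 by near: j; exact: g_phi.
have j4 : incr_at (f (phi j)) (g (phi j)) s t (f0 t) <= m.+1%:R^-1.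
  by apply: incr_le; near: j; exact: phi_calm.
rewrite (_ : e = 5 * (e / 5)); last by rewrite mulrC divfK.
apply: (mdist_lt_of_incr_at (g := g (phi j)) (g' := g0) (s := s)) => //;
  exact: le_trans (ltW me).
Unshelve. all: by end_near. Qed.
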